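(* Let $t\geq 2$ and $m\geq 1$ be integers, and set $\alpha=\alpha_{m,t}(1)=\frac{mt+t+1}{2(m+2)}$. Then the largest size of a $(t, mt+1)$-core partition with distinct parts is \[ \begin{cases} -\lfloor \alpha\rfloor^2\cdot \frac{m^2+2m}{2} + \lfloor \alpha\rfloor \cdot \frac{m^2t+mt+m}{2}, & \text{if } \{\alpha\}\leq 1/2, \\ -\lfloor \alpha+1\rfloor^2\cdot \frac{m^2+2m}{2} + \lfloor \alpha+1\rfloor \cdot \frac{m^2t+mt+m}{2}, & \text{if } \{\alpha\}> 1/2. \end{cases} \] Moreover, the number of $(t,mt+1)$-core partitions with distinct parts having this largest size is $2$ if $\{\alpha\}=1/2$, and $1$ if $\{\alpha\}\neq 1/2$.
   Context: A partition is a finite weakly decreasing sequence $\lambda=(\lambda_1,\ldots,\lambda_\ell)$ of positive integers; its size is $\sum_i\lambda_i$, and it has distinct parts if $\lambda_1>\lambda_2>\cdots>\lambda_\ell$. In the Young diagram of $\lambda$ (row $i$ has $\lambda_i$ left-justified boxes), the hook length of box $(i,j)$ is the number of boxes directly to its right, directly below it, plus the box itself. For a positive integer $s$, $\lambda$ is an $s$-core partition if no hook length is divisible by $s$; it is a $(t_1,t_2)$-core partition if it is both a $t_1$-core and a $t_2$-core. For $m,t\in\mathbb{N}$ and $x\in\mathbb{Z}$, $\alpha_{m,t}(x):=\frac{mt+t+x}{2(m+2)}$. $\lfloor x\rfloor$ is the largest integer not exceeding $x$ and $\{x\}=x-\lfloor x\rfloor$ is the fractional part. *)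

(* Defs.v *)
From HB Require Import structures.
From mathcomp Require Import all_boot all_order all_algebra.

Set Implicit Arguments.
Unset Strict Implicit.
Unset Printing Implicit Defensive.

Import Order.TTheory GRing.Theory Num.Theory.

(* Partitions are finite sequences of natural numbers; the empty partition is
   [::], of size [sumn [::] = 0]. *)

Definition is_partition (la : seq nat) : bool :=
  sorted geq la && all (fun k => 0 < k) la.

Definition distinct_parts (la : seq nat) : bool := sorted gtn la.

(* Rows and columns are numbered from 0: (i, j) is a box of la when
   i < size la and j < nth 0 la i. *)

Definition arm (la : seq nat) (i j : nat) : nat := nth 0 la i - j.+1.

Definition leg (la : seq nat) (i j : nat) : nat :=
  count (fun r => j < r) (drop i.+1 la).

Definition hook_length (la : seq nat) (i j : nat) : nat :=
  arm la i j + leg la i j + 1.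

Definition is_core (s : nat) (la : seq nat) : Prop :=
  forall i j : nat, i < size la -> j < nth 0 la i -> ~~ (s %| hook_length la i j).

Definition is_core2 (t1 t2 : nat) (la : seq nat) : Prop :=
  is_core t1 la /\ is_core t2 la.

Definition distinct_core (t1 t2 : nat) (la : seq nat) : Prop :=
  [/\ is_partition la, distinct_parts la & is_core2 t1 t2 la].

Definition largest_size (P : seq nat -> Prop) (N : nat) : Prop :=
  (exists2 la, P la & sumn la = N) /\ (forall la, P la -> sumn la <= N).

Definition has_exactly (P : seq nat -> Prop) (k : nat) : Prop :=
  exists s : seq (seq nat),
    [/\ uniq s, forall la, la \in s <-> P la & size s = k].

Local Open Scope ring_scope.

Definition alpha (m t : nat) (x : int) : rat :=
  (m%:R * t%:R + t%:R + x%:~R) / (2%:R * (m%:R + 2%:R)).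

Definition frac_part (x : rat) : rat := x - (Num.floor x)%:~R.

Definition size_formula (m t : nat) (k : int) : rat :=
  - (k%:~R ^+ 2) * ((m%:R ^+ 2 + 2%:R * m%:R) / 2%:R)
  + k%:~R * ((m%:R ^+ 2 * t%:R + m%:R * t%:R + m%:R) / 2%:R).

(* Main.v *)
(** Encode a partition by its beta-set [B], the set of first-column hook lengths:
    the hook lengths of the row with beta-number [y] are the [y - x] for [x < y]
    outside [B].  Thus [(t, mt+1)]-cores with distinct parts correspond to the sets
    [B] that avoid [0], contain no two consecutive integers and are closed under
    subtracting [t] and [mt+1]; these lie below [mt].  Cut [B] into rows
    [R_0, ..., R_(m-1)] of length [t], with sizes [n_0 >= n_1 >= ...].  Then

      [2|la| = sum_k g(n_k) - 2 sum_k (n_k (t - n_k) - sum R_k)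
               - sum_(k < l) (n_k - n_l)(t - (n_k - n_l))]

    where [g(n) = n((m+1)t + 1 - (m+2)n) = (m+2)(alpha^2 - (n - alpha)^2)].  The
    second sum vanishes exactly when every row is [{t-1, t-3, ...}], the third
    exactly when all rows have the same size, and both are nonnegative.  So the
    largest cores have [m] equal rows of [n] elements each, with [n] an integer
    nearest to [alpha], and there are two of these exactly when [{alpha} = 1/2]. *)

Require Import Defs.
From HB Require Import structures.
From mathcomp Require Import all_boot all_order all_algebra.
From mathcomp Require Import zify ring lra.

Import Order.TTheory GRing.Theory Num.Theory.

Set Implicit Arguments.
Unset Strict Implicit.
Unset Printing Implicit Defensive.

(** * Sequences with gaps *)

Definition gap2 (x y : nat) : bool := y + 2 <= x.

Lemma geq_trans : transitive geq.
Proof. by move=> y x z /= yx zy; exact: leq_trans zy yx. Qed.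

Lemma gtn_trans : transitive gtn.
Proof. by move=> y x z /= yx zy; exact: ltn_trans zy yx. Qed.

Lemma gtn_irr : irreflexive gtn.
Proof. exact: ltnn. Qed.

Lemma gap2_trans : transitive gap2.
Proof. by move=> y x z; rewrite /gap2; lia. Qed.

Lemma sorted_gap2_gtn s : sorted gap2 s -> sorted gtn s.
Proof. by apply: sub_sorted => x y; rewrite /gap2 /=; lia. Qed.

Lemma sorted_gap2P s :
  sorted gap2 s <-> sorted gtn s /\ (forall x, x \in s -> x.+1 \notin s).
Proof.
elim: s => [|x s IH] //=.
rewrite (path_sortedE gap2_trans) (path_sortedE gtn_trans).
split=> [/andP[/allP gap_x /IH[-> gap_s]]|[/andP[/allP gt_x sorted_s] gap_xs]].
  rewrite andbT; split=> [|y].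
    by apply/allP => y /gap_x; rewrite /gap2 /=; lia.
  rewrite !inE negb_or => /predU1P[->|ys].
    by rewrite gtn_eqF //=; apply/negP => /gap_x; rewrite /gap2; lia.
  by rewrite gap_s // andbT; have := gap_x _ ys; rewrite /gap2; lia.
apply/andP; split.
  apply/allP => y ys; have := gt_x _ ys; have := gap_xs y.
  by rewrite !inE ys orbT negb_or => /(_ isT)/andP[]; rewrite /gap2 /=; lia.
apply/IH; split=> // y ys; have := gap_xs y.
by rewrite !inE ys orbT negb_or => /(_ isT)/andP[].
Qed.

(* The sentinel [t.+1] bounds the entries of [c] by [t - 1]. *)
Definition sparse (t : nat) (c : seq nat) : bool := path gap2 t.+1 c && (0 \notin c).

Lemma sparse_gtn t c : sparse t c -> sorted gtn c.
Proof. by move=> /andP[/path_sorted/sorted_gap2_gtn]. Qed.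

Lemma sparse_ltn t c x : sparse t c -> x \in c -> x < t.
Proof.
by move=> /andP[/(order_path_min gap2_trans)/allP c_lt _] /c_lt; rewrite /gap2; lia.
Qed.

Lemma sparse_cons t x c : sparse t (x :: c) = [&& 0 < x, x < t & sparse x.-1 c].
Proof.
rewrite /sparse /= inE negb_or; case: x => [|x] /=; first by rewrite !andbF.
by rewrite /gap2 addn2 !ltnS andbA.
Qed.

Lemma size_sparse t c : sparse t c -> 2 * size c <= t.
Proof.
elim: c t => [|x c IH] t //=.
by rewrite sparse_cons => /and3P[x_gt0 xt /IH]; lia.
Qed.

Fixpoint top_row (t n : nat) : seq nat :=
  if n is n'.+1 then t.-1 :: top_row t.-2 n' else [::].

Lemma size_top_row t n : size (top_row t n) = n.
Proof. by elim: n t => //= n IH t; rewrite IH. Qed.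

Lemma sparse_top_row t n : 2 * n <= t -> sparse t (top_row t n).
Proof.
elim: n t => [|n IH] t nt; first by rewrite /sparse.
by rewrite sparse_cons IH; lia.
Qed.

Lemma sumn_sparse_leqif t c : sparse t c ->
  sumn c + size c ^ 2 <= size c * t ?= iff (c == top_row t (size c)).
Proof.
elim: c t => [|x c IH] t; first by move=> _; apply/leqifP; rewrite eqxx.
rewrite sparse_cons eqseq_cons => /and3P[x_gt0 xt sparse_c].
have [sum_le sum_eq] := IH _ sparse_c; have size_le := size_sparse sparse_c.
have [xE|xE] /= := eqVneq x t.-1; last first.
  by apply/leqifP; rewrite -!mulnn in sum_le *; nia.
rewrite /= -xE -sum_eq -!mulnn in sum_le *.
by split; [|apply/eqP/eqP]; nia.
Qed.

Lemma sumn_top_row t n : 2 * n <= t -> sumn (top_row t n) + n ^ 2 = n * t.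
Proof.
move=> nt; have := sumn_sparse_leqif (sparse_top_row nt).
by rewrite size_top_row eqxx => -[_ /eqP].
Qed.

(** * Beta-sets *)

Fixpoint beta (la : seq nat) : seq nat :=
  if la is a :: la' then a + size la' :: beta la' else [::].

Fixpoint unbeta (s : seq nat) : seq nat :=
  if s is x :: s' then x - size s' :: unbeta s' else [::].

Lemma size_beta la : size (beta la) = size la.
Proof. by elim: la => //= a la ->. Qed.

Lemma betaK : cancel beta unbeta.
Proof. by elim=> //= a la ->; rewrite size_beta addnK. Qed.

Lemma size_unbeta s : size (unbeta s) = size s.
Proof. by elim: s => //= x s ->. Qed.

Lemma path_gtn_size x s : path gtn x s -> size s <= x.
Proof. by elim: s x => //= y s IH x /andP[yx /IH]; lia. Qed.

Lemma unbetaK s : sorted gtn s -> beta (unbeta s) = s.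
Proof.
elim: s => //= x s IH xs.
by rewrite IH ?(path_sorted xs) // size_unbeta subnK // path_gtn_size.
Qed.

Lemma sumn_beta la :
  2 * sumn (beta la) + size la = 2 * sumn la + size la * size la.
Proof. by elim: la => //= a la; lia. Qed.

Lemma sorted_gtn_beta la : sorted gtn (beta la) = sorted geq la.
Proof.
case: la => //= a la; elim: la a => //= b la IH a.
by rewrite IH; congr andb; lia.
Qed.

Lemma sorted_gap2_beta la : sorted gap2 (beta la) = sorted gtn la.
Proof.
case: la => //= a la; elim: la a => //= b la IH a.
by rewrite IH /gap2; congr andb; lia.
Qed.

Lemma beta_ltn a la x : path geq a la -> x \in beta la -> x < a + size la.
Proof.
rewrite -[path _ _ _]/(sorted geq (a :: la)) -sorted_gtn_beta /=.
by move=> /(order_path_min gtn_trans)/allP/[apply].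
Qed.

Lemma mem0_beta la : sorted geq la -> (0 \in beta la) = (0 \in la).
Proof.
elim: la => //= a la IH ala; rewrite !inE IH ?(path_sorted ala) //.
case: la ala {IH} => [|b la] /=; first by rewrite addn0.
case: a => [|a] //; rewrite leqn0 addnS => /andP[/eqP-> _].
by rewrite inE eqxx.
Qed.

(** * Hook lengths and cores *)

Definition shift_closed (s : nat) (B : seq nat) : Prop :=
  forall x, x + s \in B -> x \in B.

Lemma shift_closedM q s B : shift_closed s B -> shift_closed (q * s) B.
Proof.
move=> closed_s; elim: q => [|q IH] x; first by rewrite addn0.
by rewrite mulSn addnA => /IH/closed_s.
Qed.

Definition short_rows (la : seq nat) (j : nat) : nat := count (fun r => r <= j) la.

Lemma short_rows_leq la j : short_rows la j <= size la.
Proof. exact: count_size. Qed.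

Lemma short_rows_full a la j : path geq a la -> a <= j -> short_rows la j = size la.
Proof.
move=> /(order_path_min geq_trans) a_ge aj.
by apply/eqP; rewrite -all_count; apply: sub_all a_ge => r /= /leq_trans->.
Qed.

Lemma first_row_hook_length a la j : j < a ->
  hook_length (a :: la) 0 j = a + size la - (j + short_rows la j).
Proof.
have rows_split : short_rows la j + count (fun r => j < r) la = size la.
  rewrite -(count_predC (fun r => r <= j)); congr addn.
  by apply: eq_count => r /=; rewrite ltnNge.
by rewrite /hook_length /arm /leg /= drop0; lia.
Qed.

Lemma notin_betaP la x : sorted geq la ->
  x \notin beta la <-> exists j, x = j + short_rows la j.
Proof.
elim: la x => [|b la IH] x bla; first by split=> // _; exists x; rewrite addn0.
have IHla y := IH y (path_sorted bla); have fullE := short_rows_full bla.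
have consE j : short_rows (b :: la) j = (b <= j) + short_rows la j by [].
rewrite inE negb_or; split=> [/andP[xb /IHla[j xE]]|[j ->]].
  have [jb|bj] := ltnP j b; first by exists j; rewrite consE leqNgt jb.
  rewrite fullE // in xE; exists j.-1.
  have bj1 : b <= j.-1 by lia.
  by rewrite consE bj1 fullE //; lia.
rewrite consE; have [bj|jb] := leqP b j.
  rewrite fullE //; apply/andP; split; first by lia.
  by apply/negP => /(beta_ltn bla); lia.
apply/andP; split; first by have := short_rows_leq la j; lia.
by apply/IHla; exists j.
Qed.

Lemma first_row_hooksP a la h : path geq a la ->
  (exists2 j, j < a & h = hook_length (a :: la) 0 j) <->
  exists x, [/\ x < a + size la, x \notin beta la & h = a + size la - x].
Proof.
move=> ala; have gapP x := notin_betaP x (path_sorted ala).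
split=> [[j ja ->]|[x [xlt /gapP[j xE] ->]]].
  exists (j + short_rows la j); rewrite first_row_hook_length //; split=> //.
    by have := short_rows_leq la j; lia.
  by apply/gapP; exists j.
have ja : j < a.
  rewrite ltnNge; apply/negP => aj.
  by rewrite xE (short_rows_full ala) // ltnNge leq_add2r aj in xlt.
by exists j; rewrite // xE first_row_hook_length.
Qed.

Lemma is_core_cons s a la : is_core s (a :: la) <->
  (forall j, j < a -> ~~ (s %| hook_length (a :: la) 0 j)) /\ is_core s la.
Proof.
split=> [core|[core0 core] [|i] j].
- by split=> [j|i j]; [exact: (core 0)|exact: (core i.+1)].
- by move=> _; exact: core0.
- exact: core.
Qed.

Lemma is_core_betaP s la : sorted geq la -> is_core s la <->
  forall y x, y \in beta la -> x < y -> x \notin beta la -> ~~ (s %| y - x).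
Proof.
elim: la => [|a la IH] ala; first by split=> // _ i j.
have beta_lt x := @beta_ltn a la x ala.
rewrite is_core_cons IH ?(path_sorted ala) //=; split=> [[row0 rows] y x|hooks].
  rewrite !inE negb_or => /predU1P[->|yla] xy /andP[_ xla]; last exact: rows.
  have [_ gap_hook] := first_row_hooksP (a + size la - x) ala.
  by have [|j ja ->] := gap_hook; [exists x|exact: row0].
split=> [j ja|y x yla xy xla].
  have [hook_gap _] := first_row_hooksP (hook_length (a :: la) 0 j) ala.
  have [|x [xlt xla ->]] := hook_gap; first by exists j.
  by apply: hooks; rewrite ?inE ?eqxx // negb_or xla ltn_eqF.
apply: hooks; rewrite // inE ?yla ?orbT // negb_or xla andbT.
by rewrite ltn_eqF // (ltn_trans xy) // beta_lt.
Qed.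

Lemma is_core_shift_closed s la :
  sorted geq la -> is_core s la <-> shift_closed s (beta la).
Proof.
move=> la_sorted; rewrite is_core_betaP //; split=> [hooks x|closed_s y x].
  case: s hooks => [|s] hooks; first by rewrite addn0.
  move=> xs; apply: contraT => x_gap.
  by have := hooks _ x xs; rewrite addKn dvdnn; apply=> //; lia.
move=> yB xy; apply: contra => /dvdnP[q yxE].
by apply: (shift_closedM (q := q) closed_s); rewrite -yxE subnKC // ltnW.
Qed.

Definition distinct_core_beta (t1 t2 : nat) (B : seq nat) : Prop :=
  [/\ sorted gap2 B, 0 \notin B, shift_closed t1 B & shift_closed t2 B].

Lemma distinct_core_betaP t1 t2 la :
  distinct_core t1 t2 la <-> distinct_core_beta t1 t2 (beta la).
Proof.
have all_gt0 : all (fun k => 0 < k) la = (0 \notin la).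
  by rewrite -has_pred1 -all_predC; apply: eq_all => k; rewrite /= lt0n.
rewrite /distinct_core /distinct_core_beta sorted_gap2_beta /is_partition all_gt0.
split=> [[/andP[la_sorted la0] dist [core1 core2]]|[dist B0 closed1 closed2]].
  by split; rewrite ?mem0_beta //; apply/is_core_shift_closed.
have la_sorted : sorted geq la.
  by rewrite -sorted_gtn_beta sorted_gap2_gtn // sorted_gap2_beta.
rewrite la_sorted -mem0_beta //.
by split=> //; split; apply/is_core_shift_closed.
Qed.

(** * Rows of the abacus *)

(* Otherwise [x - (m * t + 1)] and its successor [x - m * t] both lie in [B]. *)
Lemma distinct_core_beta_ltn t m B x :
  distinct_core_beta t (m * t + 1) B -> x \in B -> x < m * t.
Proof.
move=> [/sorted_gap2P[_ gap_B] B0 closed_t closed_mt1] xB.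
have closed_mt := shift_closedM (q := m) closed_t.
rewrite ltnNge; apply/negP => mtx.
have [xE|mtx1] : x = 0 + m * t \/ m * t + 1 <= x by lia.
  by move: xB B0; rewrite xE => /closed_mt->.
have /closed_mt1/gap_B/negP[] : x - (m * t + 1) + (m * t + 1) \in B by rewrite subnK.
by apply: closed_mt; have -> : (x - (m * t + 1)).+1 + m * t = x by lia.
Qed.

Definition abacus_row (t : nat) (B : seq nat) (k : nat) : seq nat :=
  [seq x %% t | x <- B & x %/ t == k].

Definition repeat_row (t m : nat) (c : seq nat) : seq nat :=
  [seq x <- rev (iota 0 (m * t)) | x %% t \in c].

Section Rows.

Variable t : nat.
Hypothesis t_gt0 : 0 < t.

Lemma mem_abacus_row B k i : (i \in abacus_row t B k) = (i < t) && (k * t + i \in B).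
Proof.
apply/mapP/andP => [[x + ->]|[it iB]].
  by rewrite mem_filter => /andP[/eqP<- xB]; rewrite ltn_pmod // -divn_eq.
exists (k * t + i); last by rewrite modnMDl modn_small.
by rewrite mem_filter divnMDl // divn_small // addn0 eqxx.
Qed.

Lemma abacus_row_sparse B k : sorted gap2 B -> 0 \notin B -> shift_closed t B ->
  sparse t (abacus_row t B k).
Proof.
move=> gap_B B0 closed_t; rewrite /sparse (path_sortedE gap2_trans) -andbA.
apply/and3P; split.
- by apply/allP => i; rewrite mem_abacus_row /gap2 => /andP[]; lia.
- have /sorted_filter-/(_ gap2_trans (fun x => x %/ t == k)) := gap_B.
  apply: (homo_sorted_in (P := [pred x | x %/ t == k])); last exact: filter_all.
  move=> x y /eqP xk /eqP yk; rewrite /gap2 [x in _ <= x](divn_eq x t).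
  by rewrite [y in y + _ <= _](divn_eq y t) xk yk -addnA leq_add2l.
- rewrite mem_abacus_row t_gt0 addn0 /=.
  by apply: contra B0; exact: (@shift_closedM k t B closed_t 0).
Qed.

Lemma size_abacus_row_geq B k l : sorted gap2 B -> 0 \notin B -> shift_closed t B ->
  k <= l -> size (abacus_row t B l) <= size (abacus_row t B k).
Proof.
move=> gap_B B0 closed_t kl; apply: uniq_leq_size.
  apply: (sorted_uniq gtn_trans gtn_irr).
  exact: sparse_gtn (abacus_row_sparse l gap_B B0 closed_t).
move=> i; rewrite !mem_abacus_row => /andP[-> /=].
by rewrite -(subnKC kl) mulnDl addnAC => /(shift_closedM closed_t).
Qed.

Lemma mem_repeat_row m c x : (x \in repeat_row t m c) = (x %% t \in c) && (x < m * t).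
Proof. by rewrite mem_filter mem_rev mem_iota. Qed.

Lemma repeat_row_gtn m c : sorted gtn (repeat_row t m c).
Proof.
by apply: (sorted_filter gtn_trans); rewrite rev_sorted; exact: iota_ltn_sorted.
Qed.

Lemma repeat_row_distinct_core_beta m c :
  sparse t c -> distinct_core_beta t (m * t + 1) (repeat_row t m c).
Proof.
move=> /andP[gap_c c0]; split.
- apply/sorted_gap2P; split=> [|x]; first exact: repeat_row_gtn.
  rewrite !mem_repeat_row => /andP[xc _]; rewrite negb_and.
  have /sorted_gap2P[_ /(_ _ xc) gap_x] := path_sorted gap_c.
  rewrite -addn1 -modnDml addn1.
  have := ltn_pmod x t_gt0; rewrite leq_eqVlt => /predU1P[->|xt].
    by rewrite modnn c0.
  by rewrite modn_small ?gap_x.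
- by rewrite mem_repeat_row mod0n (negbTE c0).
- by move=> x; rewrite !mem_repeat_row modnDr => /andP[-> /=]; lia.
- by move=> x; rewrite !mem_repeat_row => /andP[_]; lia.
Qed.

Lemma abacus_row_repeat_row m c k :
  sparse t c -> k < m -> abacus_row t (repeat_row t m c) k = c.
Proof.
move=> sparse_c km.
have [gap_B B0 closed_t _] := repeat_row_distinct_core_beta m sparse_c.
apply: (irr_sorted_eq gtn_trans gtn_irr).
- exact: sparse_gtn (abacus_row_sparse k gap_B B0 closed_t).
- exact: sparse_gtn sparse_c.
move=> i; rewrite mem_abacus_row mem_repeat_row modnMDl.
apply/andP/idP => [[it /andP[]]|ic]; first by rewrite modn_small.
have it := sparse_ltn sparse_c ic.
by rewrite it modn_small // ic; split=> //=; nia.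
Qed.

Section BoundedBeta.

Variables (m : nat) (B : seq nat).
Hypothesis B_lt : forall x, x \in B -> x < m * t.

Lemma big_abacus_rows (R : Type) (idx : R) (op : Monoid.com_law idx) F :
  \big[op/idx]_(x <- B) F x =
  \big[op/idx]_(k < m) \big[op/idx]_(i <- abacus_row t B k) F (k * t + i).
Proof.
under [RHS]eq_bigr => k _.
  rewrite big_map big_filter.
  under eq_bigr => x /eqP<- do rewrite -divn_eq.
  over.
rewrite (exchange_big_dep xpredT) //= !big_seq; apply: eq_bigr => x /B_lt xlt.
have xm : x %/ t < m by rewrite ltn_divLR.
by rewrite (big_pred1 (Ordinal xm)).
Qed.

Lemma sumn_abacus_rows :
  sumn B = \sum_(k < m) (k * t * size (abacus_row t B k) + sumn (abacus_row t B k)).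
Proof.
rewrite sumnE big_abacus_rows; apply: eq_bigr => k _.
by rewrite big_split /= big_const_seq count_predT iter_addn_0 sumnE.
Qed.

Lemma size_abacus_rows : size B = \sum_(k < m) size (abacus_row t B k).
Proof.
by rewrite -sum1_size big_abacus_rows; apply: eq_bigr => k _; rewrite sum1_size.
Qed.

Lemma eq_repeat_row c : sorted gtn B ->
  (forall k, k < m -> abacus_row t B k = c) -> B = repeat_row t m c.
Proof.
move=> B_gtn rowE.
apply: (irr_sorted_eq gtn_trans gtn_irr) => //; first exact: repeat_row_gtn.
move=> x; rewrite mem_repeat_row; have [xmt|mtx] := ltnP x (m * t).
  by rewrite andbT -(rowE (x %/ t)) ?ltn_divLR // mem_abacus_row ltn_pmod // -divn_eq.
by rewrite andbF; apply/negP => /B_lt; rewrite ltnNge mtx.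
Qed.

End BoundedBeta.

End Rows.

(** * The size of a core *)

Local Open Scope ring_scope.

Lemma sum_pairwise_gapsE (R : comNzRingType) (t : R) (n : nat -> R) m :
  \sum_(l < m) \sum_(k < l) (n k - n l) * (t - (n k - n l)) =
  t * (\sum_(k < m) (m%:R - 1 - 2 * k%:R) * n k) - m%:R * (\sum_(k < m) n k ^+ 2)
  + (\sum_(k < m) n k) ^+ 2.
Proof.
elim: m => [|m IH]; first by rewrite !big_ord0; ring.
have lastE : \sum_(k < m) (n k - n m) * (t - (n k - n m)) =
    (t + 2 * n m) * (\sum_(k < m) n k) - \sum_(k < m) n k ^+ 2
    - m%:R * (t * n m + n m ^+ 2).
  have <- : \sum_(k < m) (t * n m + n m ^+ 2) = m%:R * (t * n m + n m ^+ 2).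
    by rewrite sumr_const card_ord mulr_natl.
  rewrite mulr_sumr -!sumrB.
  by apply: eq_bigr => k _; ring.
have weightsE : \sum_(k < m) (m.+1%:R - 1 - 2 * k%:R) * n k =
    \sum_(k < m) (m%:R - 1 - 2 * k%:R) * n k + \sum_(k < m) n k.
  by rewrite -big_split /=; apply: eq_bigr => k _; rewrite -natr1; ring.
rewrite !big_ord_recr /= IH lastE weightsE -natr1; ring.
Qed.

Lemma pairwise_gap_leif (R : realDomainType) (t x y : R) :
  y <= x -> x - y < t -> 0 <= (x - y) * (t - (x - y)) ?= iff (x == y).
Proof.
move=> yx xyt; apply/leifP; case: eqVneq => [->|x_neq_y]; first by rewrite subrr mul0r.
by rewrite mulr_gt0 ?subr_gt0 // lt_neqAle eq_sym x_neq_y.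
Qed.

Definition row_share (t m : nat) (n : rat) : rat :=
  n * ((m%:R + 1) * t%:R + 1 - (m%:R + 2) * n).

Definition top_partition (t m n : nat) : seq nat :=
  unbeta (repeat_row t m (top_row t n)).

Section CoreSize.

Variables t m : nat.
Hypothesis t_gt0 : (0 < t)%N.

Lemma sumn_row_sharesE la (r := abacus_row t (beta la))
    (n := fun k => (size (r k))%:R : rat) :
  (forall x, x \in beta la -> (x < m * t)%N) ->
  2 * (sumn la)%:R =
  \sum_(k < m) row_share t m (n k)
  - 2 * (\sum_(k < m) (n k * t%:R - (n k ^+ 2 + (sumn (r k))%:R)))
  - \sum_(l < m) \sum_(k < l) (n k - n l) * (t%:R - (n k - n l)).
Proof.
move=> B_lt; rewrite sum_pairwise_gapsE.
have sizeE : (size la)%:R = \sum_(k < m) n k.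
  by rewrite -size_beta (size_abacus_rows t_gt0 B_lt) natr_sum.
have sumE : (sumn (beta la))%:R = \sum_(k < m) (k%:R * t%:R * n k + (sumn (r k))%:R).
  rewrite (sumn_abacus_rows t_gt0 B_lt) natr_sum.
  by apply: eq_bigr => k _; rewrite natrD !natrM.
have rowwiseE :
    2 * (\sum_(k < m) (k%:R * t%:R * n k + (sumn (r k))%:R)) + \sum_(k < m) n k =
    \sum_(k < m) row_share t m (n k)
    - 2 * (\sum_(k < m) (n k * t%:R - (n k ^+ 2 + (sumn (r k))%:R)))
    - t%:R * (\sum_(k < m) (m%:R - 1 - 2 * k%:R) * n k)
    + m%:R * (\sum_(k < m) n k ^+ 2).
  rewrite !mulr_sumr -!sumrB -!big_split /=.
  by apply: eq_bigr => k _; rewrite /row_share; ring.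
have /(congr1 (fun j => j%:R : rat)) := sumn_beta la.
by rewrite !natrD !natrM sizeE sumE => sumn_la; lra.
Qed.

Lemma distinct_core_size_leif (K : rat) la (r := abacus_row t (beta la)) :
  distinct_core t (m * t + 1) la ->
  (forall n : nat, row_share t m n%:R <= K) ->
  2 * (sumn la)%:R <= m%:R * K ?= iff
    [&& [forall k : 'I_m, row_share t m (size (r k))%:R == K],
        [forall k : 'I_m, r k == top_row t (size (r k))]
      & [forall l : 'I_m, forall k : 'I_l, size (r k) == size (r l)]].
Proof.
move=> /distinct_core_betaP B_core share_le.
have B_lt x := distinct_core_beta_ltn (x := x) B_core.
have [gap_B B0 closed_t _] := B_core.
have sparse_r k : sparse t (r k) by exact: abacus_row_sparse.
have shares_leif : \sum_(k < m) row_share t m (size (r k))%:R <= m%:R * K ?= iff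
    [forall k : 'I_m, row_share t m (size (r k))%:R == K].
  have <- : \sum_(k < m) K = m%:R * K by rewrite sumr_const card_ord mulr_natl.
  by apply: leif_sum => k _; apply: leif_eq.
have tops_leif : 0 <= 2 * (\sum_(k < m) ((size (r k))%:R * t%:R -
    ((size (r k))%:R ^+ 2 + (sumn (r k))%:R))) ?= iff
    [forall k : 'I_m, r k == top_row t (size (r k))] :> rat.
  rewrite -[0](mulr0 2) (mono_leif (ler_pM2l _)) //.
  apply: leif_0_sum => k _; rewrite leifBRL add0r.
  rewrite -natrM -natrX -natrD addnC leif_nat_r.
  exact: sumn_sparse_leqif.
have gaps_leif : 0 <= \sum_(l < m) \sum_(k < l)
    ((size (r k))%:R - (size (r l))%:R) *
    (t%:R - ((size (r k))%:R - (size (r l))%:R)) ?= iff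
    [forall l : 'I_m, forall k : 'I_l, size (r k) == size (r l)] :> rat.
  apply: leif_0_sum => l _; apply: leif_0_sum => k _.
  rewrite eqnE -(eqr_nat rat); apply: pairwise_gap_leif.
    by rewrite ler_nat size_abacus_row_geq // ltnW.
  by have := size_sparse (sparse_r k); rewrite ltrBlDr -natrD ltr_nat; lia.
have := leifD shares_leif (leifD tops_leif gaps_leif).
by rewrite (sumn_row_sharesE B_lt) !leifBLR !addr0 -addrA [_ + 2 * _]addrC.
Qed.

Lemma beta_top_partition n : beta (top_partition t m n) = repeat_row t m (top_row t n).
Proof. by rewrite unbetaK // repeat_row_gtn. Qed.

Lemma top_partition_distinct_core n : (2 * n <= t)%N ->
  distinct_core t (m * t + 1) (top_partition t m n).
Proof.
move=> nt; apply/distinct_core_betaP; rewrite beta_top_partition.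
by apply: repeat_row_distinct_core_beta; rewrite // sparse_top_row.
Qed.

Lemma abacus_row_top_partition n k : (2 * n <= t)%N -> (k < m)%N ->
  abacus_row t (beta (top_partition t m n)) k = top_row t n.
Proof.
by move=> nt km; rewrite beta_top_partition abacus_row_repeat_row // sparse_top_row.
Qed.

Lemma sumn_top_partition n : (2 * n <= t)%N ->
  2 * (sumn (top_partition t m n))%:R = m%:R * row_share t m n%:R.
Proof.
move=> nt; have rowE k := abacus_row_top_partition (k := k) nt.
have sizeE k : (k < m)%N -> size (abacus_row t (beta (top_partition t m n)) k) = n.
  by move=> km; rewrite rowE // size_top_row.
rewrite sumn_row_sharesE => [|x]; last first.
  by rewrite beta_top_partition mem_repeat_row => /andP[].
rewrite [X in 2 * X]big1 => [|k _]; last first.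
  rewrite sizeE // rowE // -natrX -natrD -natrM.
  by rewrite addnC sumn_top_row // subrr.
rewrite [X in _ - X]big1 => [|l _]; last first.
  apply: big1 => k _; rewrite !sizeE ?subrr ?mul0r //.
  exact: ltn_trans (ltn_ord k) (ltn_ord l).
rewrite mulr0 !subr0 (eq_bigr (fun=> row_share t m n%:R)) => [|k _].
  by rewrite sumr_const card_ord mulr_natl.
by rewrite sizeE.
Qed.

Hypothesis m_gt0 : (0 < m)%N.

Lemma top_partition_inj :
  {in [pred n | (2 * n <= t)%N] &, injective (top_partition t m)}.
Proof.
move=> n1 n2 n1t n2t top_eq.
rewrite -(size_top_row t n1) -(abacus_row_top_partition n1t m_gt0) top_eq.
by rewrite abacus_row_top_partition // size_top_row.
Qed.

Lemma distinct_core_eq_top_partition (K : rat) la :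
  distinct_core t (m * t + 1) la ->
  (forall n : nat, row_share t m n%:R <= K) -> 2 * (sumn la)%:R = m%:R * K ->
  exists2 n : nat, row_share t m n%:R = K & la = top_partition t m n.
Proof.
move=> core share_le sizeE.
have [_] := distinct_core_size_leif core share_le.
rewrite sizeE eqxx => /esym/and3P[/forallP shares /forallP tops /forallP gaps].
have /distinct_core_betaP B_core := core; have [gap_B _ _ _] := B_core.
exists (size (abacus_row t (beta la) 0)).
  exact/eqP/(shares (Ordinal m_gt0)).
rewrite -[la in LHS]betaK; congr unbeta.
apply: eq_repeat_row => // [x||k km]; first exact: distinct_core_beta_ltn B_core.
  exact: sorted_gap2_gtn.
rewrite (eqP (tops (Ordinal km))); congr top_row.
case: k km => // k km.
by have /forallP/(_ (@Ordinal k.+1 0 isT))/eqP := gaps (Ordinal km).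
Qed.

Section BestShare.

Variable k : nat.
Hypothesis kt : (2 * k <= t)%N.
Hypothesis share_le : forall n : nat, row_share t m n%:R <= row_share t m k%:R.

Lemma largest_top_partition :
  largest_size (distinct_core t (m * t + 1)) (sumn (top_partition t m k)).
Proof.
split=> [|la core].
  by exists (top_partition t m k); first exact: top_partition_distinct_core.
rewrite -(ler_nat rat) -(ler_pM2l (ltr0n _ 2)) sumn_top_partition //.
by have [] := distinct_core_size_leif core share_le.
Qed.

Lemma has_exactly_largest_cores (best : seq nat) : uniq best ->
  (forall n, (n \in best) = (row_share t m n%:R == row_share t m k%:R)) ->
  {in best, forall n, 2 * n <= t}%N ->
  has_exactly (fun la => distinct_core t (m * t + 1) la /\
                         sumn la = sumn (top_partition t m k)) (size best).
Proof.
move=> best_uniq bestE best_le.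
exists [seq top_partition t m n | n <- best]; split=> [|la|]; last exact: size_map.
  rewrite map_inj_in_uniq // => n1 n2 /best_le n1t /best_le n2t.
  exact: top_partition_inj.
split=> [/mapP[n n_best ->]|[core sumE]].
  have nt := best_le n n_best; split; first exact: top_partition_distinct_core.
  apply/eqP; rewrite -(eqr_nat rat) -(inj_eq (mulfI (x := 2) _)) //.
  by rewrite !sumn_top_partition //; move: n_best; rewrite bestE => /eqP->.
have [|n n_best ->] := distinct_core_eq_top_partition core share_le.
  by rewrite sumE sumn_top_partition.
by rewrite map_f // bestE n_best.
Qed.

End BestShare.

End CoreSize.

(** * Maximizing the contribution of a row *)

Lemma row_share_alpha t m n : row_share t m n =
  (m%:R + 2) * (alpha m t 1 ^+ 2 - (n - alpha m t 1) ^+ 2).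
Proof. by rewrite /row_share /alpha; field; rewrite -natrD pnatr_eq0 addn2. Qed.

Lemma size_formulaE t m (n : int) :
  2 * size_formula m t n = m%:R * row_share t m n%:~R.
Proof. by rewrite /size_formula /row_share; field. Qed.

Definition nearest_int (a : rat) : int :=
  Num.floor (if frac_part a <= 1 / 2%:R then a else a + 1).

Definition nearest_ties (a : rat) : nat := if frac_part a == 1 / 2%:R then 2 else 1.

Lemma frac_part_itv a : 0 <= frac_part a < 1.
Proof. by have := floor_itv a; rewrite /frac_part intrD; lra. Qed.

Lemma sub_nearest_int_itv a (e := a - (nearest_int a)%:~R) :
  [/\ - (1 / 2) < e, e <= 1 / 2 & (frac_part a == 1 / 2%:R) = (e == 1 / 2)].
Proof.
rewrite /e /nearest_int; have /andP[frac_ge0 frac_lt1] := frac_part_itv a.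
have [frac_half|frac_half] := leP (frac_part a) (1 / 2%:R).
  by rewrite -/(frac_part a); split=> //; lra.
have -> : a - (Num.floor (a + 1))%:~R = frac_part a - 1.
  by rewrite floorDrz // floor1 intrD /frac_part; ring.
by split; [lra|lra|rewrite gt_eqF ?lt_eqF //; lra].
Qed.

Lemma int_mul_gap_leif (d : int) (e : rat) : - (1 / 2) < e -> e <= 1 / 2 ->
  0 <= d%:~R * (d%:~R - 2 * e) ?= iff (0 <= d < (if e == 1 / 2 then 2 else 1)%N).
Proof.
move=> e_gt e_le; apply/leifP.
have [d_lt0|d_gt0|->] := ltgtP d 0; last by rewrite mul0r; case: (e == _).
  have d_le : d%:~R <= (-1)%:~R :> rat by rewrite ler_int; lia.
  by rewrite rmorphN1 in d_le; rewrite /= nmulr_rgt0; lra.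
have [d1|d_ge2] : d = 1 \/ 2 <= d by lia.
  rewrite d1 /= mul1r; case: eqP => [->|/eqP e_neq] /=; first by lra.
  have : e < 1 / 2 by rewrite lt_neqAle e_neq.
  by lra.
have d_ge : 2 <= d%:~R :> rat by rewrite (ler_int rat 2).
case: ifP => [|_]; first by case: ifP; lia.
by rewrite mulr_gt0; lra.
Qed.

Lemma nearest_int_leif (a : rat) (n : int) :
  ((nearest_int a)%:~R - a) ^+ 2 <= (n%:~R - a) ^+ 2
    ?= iff (nearest_int a <= n < nearest_int a + (nearest_ties a)%:Z).
Proof.
have [] := sub_nearest_int_itv a; rewrite /nearest_ties.
set r := nearest_int a => e_gt e_le ->; set e := a - r%:~R in e_gt e_le *.
have sqrE : (n%:~R - a) ^+ 2 - (r%:~R - a) ^+ 2 = (n - r)%:~R * ((n - r)%:~R - 2 * e).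
  by rewrite /e rmorphB /=; ring.
rewrite -(mono_leif (lerD2r (- (r%:~R - a) ^+ 2))) /= subrr sqrE.
have -> : (r <= n < r + (if e == 1 / 2 then 2 else 1)%N) =
    (0 <= n - r < (if e == 1 / 2 then 2 else 1)%N).
  by rewrite subr_ge0 ltrBlDl.
exact: int_mul_gap_leif.
Qed.

Lemma sub_nearest_int_le (a : rat) (n : int) :
  n < nearest_int a + (nearest_ties a)%:Z -> n%:~R - a <= 1 / 2.
Proof.
have [] := sub_nearest_int_itv a; rewrite /nearest_ties => e_gt e_le ->.
case: eqP => [e_half|_] n_lt.
  have : n%:~R <= (nearest_int a)%:~R + 1 :> rat by rewrite -(intrD _ _ 1) ler_int; lia.
  by lra.
have : n%:~R <= (nearest_int a)%:~R :> rat by rewrite ler_int; lia.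
by lra.
Qed.

Lemma nearest_int_ge0 a : 0 <= a -> 0 <= nearest_int a.
Proof.
move=> a_ge0; rewrite /nearest_int; case: ifP => _; rewrite floor_ge0 //.
exact: addr_ge0.
Qed.

Lemma row_share_leif t m (n : int) (k := nearest_int (alpha m t 1)) :
  row_share t m n%:~R <= row_share t m k%:~R
    ?= iff (k <= n < k + (nearest_ties (alpha m t 1))%:Z).
Proof.
rewrite !row_share_alpha (mono_leif (ler_pM2l _)); last by rewrite ltr_wpDl.
rewrite (mono_leif (lerD2l _)) (nmono_leif (f := -%R) (@lerN2 rat)).
exact: nearest_int_leif.
Qed.

Lemma double_leq_alpha t m n :
  (2 <= t)%N -> n%:R - alpha m t 1 <= 1 / 2 -> (2 * n <= t)%N.
Proof.
have m2_gt0 : 0 < 2 * (m%:R + 2) :> rat by rewrite mulr_gt0 // ltr_wpDl.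
move=> t_ge2; rewrite lerBlDr /alpha -(ler_pM2r m2_gt0) (mulrDl (1 / 2)).
rewrite divfK ?gt_eqF //.
have -> : 1 / 2 * (2 * (m%:R + 2)) = (m + 2)%N%:R :> rat by rewrite natrD; field.
by rewrite -!(natrD, natrM) ler_nat; nia.
Qed.

Theorem theorem1p1 (t m : nat) (ht : (2 <= t)%N) (hm : (1 <= m)%N) :
  let a := alpha m t 1 in
  exists N : nat,
    [/\ largest_size (distinct_core t (m * t + 1)) N,
        N%:R = (if frac_part a <= 1 / 2%:R
                then size_formula m t (Num.floor a)
                else size_formula m t (Num.floor (a + 1)))
      & has_exactly
          (fun la => distinct_core t (m * t + 1) la /\ sumn la = N)
          (if frac_part a == 1 / 2%:R then 2%N else 1%N)].
Proof.
move=> a; have t_gt0 : (0 < t)%N := ltnW ht.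
have a_ge0 : 0 <= a by rewrite divr_ge0 ?addr_ge0 ?mulr_ge0 ?addr_ge0.
have [k kE] : exists k : nat, nearest_int a = k%:Z.
  by exists (absz (nearest_int a)); rewrite gez0_abs // nearest_int_ge0.
have share_leif (n : nat) : row_share t m n%:R <= row_share t m k%:R
    ?= iff (n \in iota k (nearest_ties a)).
  by have := row_share_leif t m n; rewrite -/a kE mem_iota.
have best_le : {in iota k (nearest_ties a), forall n, 2 * n <= t}%N.
  move=> n; rewrite mem_iota => /andP[_ n_lt].
  apply: (@double_leq_alpha t m) => //.
  by apply: (sub_nearest_int_le (n := n)); rewrite -/a kE.
have kt : (2 * k <= t)%N by apply: best_le; have [_ <-] := share_leif k.
exists (sumn (top_partition t m k)); split.
- by apply: largest_top_partition => // n; have [] := share_leif n.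
- rewrite -(fun_if (fun b => size_formula m t (Num.floor b))) -/(nearest_int a) kE.
  by apply: (mulfI (x := 2)) => //; rewrite size_formulaE sumn_top_partition.
- rewrite -[X in has_exactly _ X](size_iota k (nearest_ties a)).
  apply: has_exactly_largest_cores; rewrite ?iota_uniq // => n.
    exact: share_leif.
  by rewrite -(share_leif n).
Qed.
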